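(* Let $\epsilon \ge 0$, and let $\mathcal{D}$ be the distribution of target examples $(x,y) \in \mathbb{R}^n\times\{\pm1\}$. For $w \in \mathbb{R}^n$ let $f_w(x) = w^\top x$, and consider the two-player zero-sum game with payoff $$\varphi(f_w,g) := \mathbb{E}_{(x,y)\sim \mathcal{D},\, z\sim p_z}\big[\log\big(1+e^{-y\, w^\top g(x,y,z)}\big)\big],$$ minimized by the classifier over $w \in \mathbb{R}^n$ and maximized by the generator over all measurable $g$ with $\|g(x,y,z)-x\|_\infty \le \epsilon$ for all $(x,y,z)$ (i.e. the generator is allowed to generate any $\ell_\infty$ perturbation of size at most $\epsilon$). Then the optimal linear classifier, i.e. a minimizer over $w$ of $\max_g \varphi(f_w,g)$, is the solution of the following $\ell_1$-regularized logistic regression: $$w^* \in \arg\min_{w \in \mathbb{R}^n} \mathbb{E}_{(x,y)\sim\mathcal{D}}\big[\log\big(1+e^{-y\, w^\top x + \epsilon\|w\|_1}\big)\big].$$ Moreover, if $w^*$ has no zero entry, then the optimal generator is $g^*(x,y) = x - y\,\epsilon\,\mathrm{sign}(w^* )$, which is deterministic (does not depend on $z$), and the pair $(f_{w^*},g^* )$ is a Nash equilibrium of the game with payoff $\varphi$.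
   Context: $p_z$ is a probability distribution on a latent space $\mathcal{Z}$, sampled independently of the data; a generator is a map $g:(x,y,z)\mapsto g(x,y,z)\in\mathbb{R}^n$. The function $\mathrm{sign}$ is applied entrywise. An optimal generator is one attaining the maximin value $\max_g\min_w \varphi(f_w,g)$. A Nash equilibrium is a pair $(f_{w^*},g^* )$ such that neither player can improve its objective by unilaterally changing strategy: $\varphi(f_{w^*},g) \le \varphi(f_{w^*},g^* ) \le \varphi(f_w,g^* )$ for every admissible generator $g$ and every $w\in\mathbb{R}^n$. *)

(* Defs.v *)
From HB Require Import structures.
From mathcomp Require Import all_boot all_order all_algebra.
From mathcomp Require Import all_classical all_reals all_analysis.

Set Implicit Arguments.
Unset Strict Implicit.
Unset Printing Implicit Defensive.

Import Order.TTheory GRing.Theory Num.Theory.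
Import numFieldNormedType.Exports.

Local Open Scope classical_set_scope.
Local Open Scope ring_scope.

(* R^n with its Borel sigma-algebra. The norm `|x| of 'cV[R]_n is the max norm,
   i.e. the l_infinity norm. *)
Definition vec (R : realType) (n : nat) :=
  g_sigma_algebraType (@open 'cV[R]_n).

(* The label set {+1, -1} is encoded by bool, with true for +1. *)
Definition label {R : realType} (y : bool) : R := if y then 1 else -1.

Definition l1norm (R : realType) (n : nat) (w : 'cV[R]_n) : R :=
  \sum_(i < n) `|w i ord0|.

Definition vsign (R : realType) (n : nat) (w : 'cV[R]_n) : 'cV[R]_n :=
  map_mx Num.sg w.

Definition linear_classifier (R : realType) (n : nat) (w : 'cV[R]_n)
  (x : 'cV[R]_n) : R := (w^T *m x) ord0 ord0.

Definition argmin (R : realType) (T : Type) (F : T -> \bar R) : set T :=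
  [set t | forall t', (F t <= F t')%E].

Section game.
Context (R : realType) (n : nat) (dZ : measure_display)
  (Z : measurableType dZ).
Variables (D : probability (vec R n * bool)%type R) (pz : probability Z R)
  (eps : R).

Definition generator := 'cV[R]_n -> bool -> Z -> 'cV[R]_n.

Definition admissible (g : generator) : Prop :=
  measurable_fun [set: (vec R n * bool) * Z]
    (fun p => g p.1.1 p.1.2 p.2 : vec R n) /\
  forall x y z, `|g x y z - x| <= eps.

(* The integrand is nonnegative, so that the expectation is always meaningful
   in [0, +oo], without any moment assumption on D. The product measure makes z
   independent of (x, y). *)
Definition payoff (f : 'cV[R]_n -> R) (g : generator) : \bar R :=
  ('E_(D \x pz)[fun p : (vec R n * bool) * Z =>
    (ln (1 + expR (- (label p.1.2 * f (g p.1.1 p.1.2 p.2)))))%R])%E.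

Definition worst_case (w : 'cV[R]_n) : \bar R :=
  ereal_sup [set payoff (linear_classifier w) g | g in admissible].

(* For some generators the infimum over w is not attained (e.g. when the
   generated examples are linearly separable). *)
Definition generator_value (g : generator) : \bar R :=
  ereal_inf [set payoff (linear_classifier w) g | w in [set: 'cV[R]_n]].

Definition optimal_generator (g : generator) : Prop :=
  admissible g /\
  forall g', admissible g' -> (generator_value g' <= generator_value g)%E.

Definition nash_equilibrium (w : 'cV[R]_n) (g : generator) : Prop :=
  [/\ admissible g,
      forall g', admissible g' ->
        (payoff (linear_classifier w) g' <= payoff (linear_classifier w) g)%E
    & forall w',
        (payoff (linear_classifier w) g <= payoff (linear_classifier w') g)%E].

Definition regularized_risk (w : 'cV[R]_n) : \bar R :=
  ('E_D[fun p : vec R n * bool =>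
    (ln (1 + expR (- (label p.2 * linear_classifier w p.1) + eps * l1norm w)))%R])%E.

Definition sign_perturbation (w x : 'cV[R]_n) (y : bool) : 'cV[R]_n :=
  x - (label y * eps) *: vsign w.

End game.

(* Main.v *)
(** With [g_w (x, y) = x - y eps sign w], Hoelder's inequality gives
    [y w.x' >= y w.x - eps |w|_1 = y w.(g_w (x, y))] for every [x'] in the
    [eps]-ball around [x]; as the logistic loss is increasing, [g_w] is a best
    response to [w], and its payoff is the regularized risk of [w].

    Let [v] minimize the regularized risk and have no zero entry. Against [g_v]
    the payoff of [w] is the regularized risk of [w] as long as the signs of [w]
    agree with those of [v], so [v] is a local minimizer of this payoff; it is a
    global one because the payoff is convex in [w]. Hence [(v, g_v)] is a saddle
    point. An optimal generator has the same finite payoff against [v] as [g_v],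
    with a pointwise smaller loss, so the losses agree almost everywhere; since
    all entries of [v] are nonzero, this is the equality case of Hoelder's
    inequality and determines the generator. *)

Require Import Defs.
From mathcomp Require Import all_boot all_order all_algebra.
From mathcomp Require Import all_classical all_reals all_analysis.
From mathcomp Require Import measurable_realfun ring lra.

Import Order.TTheory GRing.Theory Num.Theory.
Import numFieldNormedType.Exports.

Local Open Scope classical_set_scope.
Local Open Scope ring_scope.

(** * The logistic loss: monotonicity and convexity *)

Definition logistic {R : realType} (u : R) : R := ln (1 + expR u).

Lemma gt0_onepexpR (R : realType) (u : R) : 0 < 1 + expR u.
Proof. by rewrite ltr_pwDl ?ltr01 ?expR_ge0. Qed.

Lemma logistic_ge0 (R : realType) (u : R) : 0 <= logistic u.
Proof. by rewrite ln_ge0// lerDl expR_ge0. Qed.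

Lemma ler_logistic (R : realType) : {mono @logistic R : u v / u <= v}.
Proof.
move=> u v; rewrite /logistic ler_ln ?posrE ?gt0_onepexpR//.
by rewrite lerD2l ler_expR.
Qed.

Lemma logistic_inj (R : realType) : injective (@logistic R).
Proof.
move=> u v uv; apply/le_anti.
by rewrite -(ler_logistic R u) -(ler_logistic R v) uv lexx.
Qed.

(** The graph of [expR] lies above its tangent at [c]. In the weighted average of the tangent bounds
    at [a] and [b] the linear terms cancel, which leaves [expR c]. *)
Lemma expR_convex (R : realType) (t a b : R) : 0 <= t <= 1 ->
  expR ((1 - t) * a + t * b) <= (1 - t) * expR a + t * expR b.
Proof.
move=> /andP[t0 t1]; set c := _ + _.
have tangent x : expR c * (1 + (x - c)) <= expR x.
  by rewrite -[in leRHS](subrKC c x) (expRD c) ler_pM2l ?expR_gt0// expR_ge1Dx.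
have ha := ler_wpM2l (_ : 0 <= 1 - t) (tangent a).
have hb := ler_wpM2l t0 (tangent b).
apply: le_trans (lerD (ha _) hb); last by rewrite subr_ge0.
rewrite (_ : _ + _ = expR c * (1 + ((1 - t) * a + t * b - c))); last by ring.
by rewrite subrr addr0 mulr1.
Qed.

(* Dividing [1 + e^c <= e^M] by [e^M], where [c] and [M] are the convex
   combinations of [a], [b] and of their images, reduces to convexity of [expR]. *)
Lemma logistic_convex (R : realType) (t a b : R) : 0 <= t <= 1 ->
  logistic ((1 - t) * a + t * b) <= (1 - t) * logistic a + t * logistic b.
Proof.
move=> t01; set M := leRHS.
rewrite -ler_expR /logistic lnK ?posrE ?gt0_onepexpR//.
have normalized u : expR (- logistic u) + expR (u - logistic u) = 1.
  rewrite expRD -{1}[expR (- _)]mul1r -mulrDl expRN lnK ?posrE ?gt0_onepexpR//.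
  by rewrite divff// gt_eqF// gt0_onepexpR.
have h1 := @expR_convex R t (- logistic a) (- logistic b) t01.
have h2 := @expR_convex R t (a - logistic a) (b - logistic b) t01.
have := lerD h1 h2.
rewrite addrACA -!mulrDr !normalized !mulr1 subrK.
rewrite (_ : (1 - t) * - _ + _ = - M); last by rewrite /M; ring.
rewrite (_ : (1 - t) * (a - _) + _ = ((1 - t) * a + t * b) - M);
  last by rewrite /M; ring.
by rewrite expRD -{1}[expR (- _)]mul1r -mulrDl expRN ler_pdivrMr ?expR_gt0// mul1r.
Qed.

Lemma measurable_logistic (R : realType) : measurable_fun setT (@logistic R).
Proof.
apply: measurableT_comp; first exact: measurable_ln.
by apply: measurable_funD => //; exact: measurable_expR.
Qed.

(** * Borel measurability on the space of vectors *)

Lemma continuous_measurable_vec {R : realType} {n : nat} (f : 'cV[R]_n -> R) :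
  continuous f -> measurable_fun [set: vec R n] f.
Proof.
move=> /continuousP cf; apply: (measurability _ (RGenOpens.measurableE R)).
move=> _ [_ [a [b ->] <-]]; rewrite setTI; apply: sub_sigma_algebra.
exact: (cf _ (interval_open _ _)).
Qed.

Lemma measurable_vec_translation {R : realType} {n : nat} (c : 'cV[R]_n) :
  measurable_fun [set: vec R n] (fun x => x + c : vec R n).
Proof.
have /continuousP ct : continuous (fun x : 'cV[R]_n => x + c).
  by move=> x; exact: (@continuousD R _ _ idfun (cst c) x (@cvg_id _ _)
    (@cst_continuous _ _ c x)).
apply: (@measurability _ _ (vec R n) (vec R n) _ _ (@open 'cV[R]_n)) => //.
by move=> _ [B oB <-]; rewrite setTI; apply: sub_sigma_algebra; exact: ct.
Qed.

(** * Linear classifiers and the max norm *)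

Section linear_classifier.
Context {R : realType} {n : nat}.
Implicit Types w x : 'cV[R]_n.

Lemma linear_classifierE w x :
  linear_classifier w x = \sum_(i < n) w i ord0 * x i ord0.
Proof. by rewrite /linear_classifier mxE; apply: eq_bigr => i _; rewrite mxE. Qed.

Lemma linear_classifierB w x x' :
  linear_classifier w (x - x') = linear_classifier w x - linear_classifier w x'.
Proof. by rewrite /linear_classifier mulmxBr !mxE. Qed.

Lemma linear_classifierZ w a x :
  linear_classifier w (a *: x) = a * linear_classifier w x.
Proof. by rewrite /linear_classifier -scalemxAr !mxE. Qed.

Lemma linear_classifier_conv t w w' x :
  linear_classifier ((1 - t) *: w + t *: w') x =
  (1 - t) * linear_classifier w x + t * linear_classifier w' x.
Proof.
by rewrite /linear_classifier linearD !linearZ/= mulmxDl -!scalemxAl !mxE.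
Qed.

Lemma measurable_linear_classifier w :
  measurable_fun [set: vec R n] (linear_classifier w).
Proof.
rewrite (_ : linear_classifier w =
    fun x => \sum_(i < n) w i ord0 * x i ord0); last first.
  by apply/funext => x; exact: linear_classifierE.
apply: measurable_sum => i; apply: measurable_funM => //.
by apply: continuous_measurable_vec; exact: coord_continuous.
Qed.

Lemma linear_classifier_vsign w : linear_classifier w (vsign w) = l1norm w.
Proof.
rewrite linear_classifierE; apply: eq_bigr => i _.
by rewrite mxE mulrC normrEsg.
Qed.

Lemma coord_le_norm x i : `|x i ord0| <= `|x|.
Proof.
rewrite [leRHS]/Num.norm/= mx_normrE.
by apply/bigmax_geP; right; exists (i, ord0).
Qed.

Lemma norm_le_coord x e : 0 <= e -> (forall i, `|x i ord0| <= e) -> `|x| <= e.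
Proof.
move=> e0 xe; rewrite [leLHS]/Num.norm/= mx_normrE; apply/bigmax_leP; split => //.
by move=> [i j] _ /=; rewrite (ord1 j).
Qed.

End linear_classifier.

Lemma label_sq (R : realType) (y : bool) : label y * label y = 1 :> R.
Proof. by case: y; rewrite /label ?mulrNN mulr1. Qed.

Lemma norm_label (R : realType) (y : bool) : `|label y| = 1 :> R.
Proof. by case: y; rewrite /label ?normrN normr1. Qed.

(** * Margins under bounded perturbations *)

Section robust_margin.
Context {R : realType} {n : nat} (eps : R).
Hypothesis eps_ge0 : 0 <= eps.
Implicit Types (w x : 'cV[R]_n) (y : bool).

Lemma sign_perturbation_ball w x y : `|sign_perturbation eps w x y - x| <= eps.
Proof.
rewrite /sign_perturbation addrAC subrr add0r normrN.
apply: norm_le_coord => // i; rewrite !mxE normrM normrM norm_label mul1r.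
by rewrite normr_sg ger0_norm// ler_piMr// lern1 leq_b1.
Qed.

Lemma margin_sign_perturbation w w' x y :
  label y * linear_classifier w (sign_perturbation eps w' x y) =
  label y * linear_classifier w x - eps * linear_classifier w (vsign w').
Proof.
rewrite /sign_perturbation linear_classifierB linear_classifierZ mulrBr.
by rewrite mulrA mulrA label_sq mul1r.
Qed.

(** The contribution of coordinate [i] to the gap in Hoelder's inequality. The slacks are
    nonnegative on the [eps]-ball and add up to the gap, so they give both the inequality and its
    equality case. *)
Let slack w x y x' (i : 'I_n) :=
  w i ord0 * (label y * (x' i ord0 - x i ord0)) + eps * `|w i ord0|.

Let slackE w x y x' : \sum_(i < n) slack w x y x' i =
  label y * linear_classifier w x' -
  (label y * linear_classifier w x - eps * l1norm w).
Proof.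
rewrite /slack big_split/= /l1norm -mulr_sumr opprB addrCA addrC.
congr (_ + _); rewrite -mulrBr -linear_classifierB linear_classifierE mulr_sumr.
by apply: eq_bigr => i _; rewrite !mxE; ring.
Qed.

Let slack_ge0 w x y x' i : `|x' - x| <= eps -> 0 <= slack w x y x' i.
Proof.
move=> xx'; rewrite /slack -lerBlDr sub0r lerNl -mulrN.
apply: le_trans (ler_norm _) _; rewrite normrM normrN normrM norm_label mul1r.
rewrite mulrC ler_wpM2r//; apply: le_trans xx'.
by apply: le_trans (coord_le_norm _ i); rewrite !mxE.
Qed.

Lemma margin_perturbation_ge w x y x' : `|x' - x| <= eps ->
  label y * linear_classifier w x - eps * l1norm w <=
  label y * linear_classifier w x'.
Proof.
by move=> xx'; rewrite -subr_ge0 -slackE sumr_ge0// => i _; exact: slack_ge0.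
Qed.

(** Nonnegative slacks with zero sum all vanish. Each has the factor [w i ord0], which is nonzero
    and can be cancelled; the other factor then determines [x' i ord0]. *)
Lemma margin_perturbation_eq w x y x' : (forall i, w i ord0 != 0) ->
  `|x' - x| <= eps ->
  label y * linear_classifier w x' =
    label y * linear_classifier w x - eps * l1norm w ->
  x' = sign_perturbation eps w x y.
Proof.
move=> w0 xx' /eqP; rewrite -subr_eq0 -slackE => /eqP s0.
apply/matrixP => i j; rewrite (ord1 j) !mxE.
have /(_ i isT) := psumr_eq0P (fun i _ => slack_ge0 w x y x' i xx') s0.
have -> : slack w x y x' i = w i ord0 *
    (label y * (x' i ord0 - x i ord0) + eps * Num.sg (w i ord0)).
  by rewrite /slack normrEsg; ring.
move/eqP; rewrite mulf_eq0 (negbTE (w0 i))/= => /eqP s0i.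
apply/eqP; rewrite -subr_eq0; apply/eqP.
(* Multiplying by the label, whose square is 1, turns the goal into [s0i]. *)
have /mulfI : label y != 0 :> R by case: (y); rewrite /label ?oppr_eq0 oner_eq0.
apply; rewrite mulr0 -s0i -[eps * Num.sg _ in RHS]mul1r -(label_sq R y); ring.
Qed.

End robust_margin.

(** * Signs along a segment *)

(** A short enough step from [w] towards [w'] reverses no sign, because no entry of [w] is zero. The
    equation expresses this agreement of signs. *)
Lemma segment_same_signs (R : realType) (n : nat) (w w' : 'cV[R]_n) :
  (forall i, w i ord0 != 0) -> exists t : R, [/\ 0 < t, t <= 1 &
    linear_classifier ((1 - t) *: w + t *: w') (vsign w) =
    l1norm ((1 - t) *: w + t *: w')].
Proof.
move=> w0; pose d i := w' i ord0 - w i ord0.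
(* A step [t <= r i] moves coordinate [i] by at most its absolute value. The first summand keeps the
   denominator positive even if [d i = 0]. *)
pose r i := `|w i ord0| / (`|w i ord0| + `|d i|).
have wd i : 0 < `|w i ord0| + `|d i| by rewrite ltr_pwDl// normr_gt0.
have r_gt0 i : 0 < r i by rewrite divr_gt0// normr_gt0.
(* The default value 1 yields [t <= 1] and covers [n = 0]. *)
exists (\big[Num.min/1]_i r i); set t := \big[_/_]_i _.
have t_gt0 : 0 < t by apply: lt_bigmin.
split => //; first exact: bigmin_le_id.
rewrite linear_classifierE; apply: eq_bigr => i _; rewrite !mxE.
have -> : (1 - t) * w i ord0 + t * w' i ord0 = w i ord0 + t * d i.
  by rewrite /d; ring.
have : `|t * d i| <= `|w i ord0|.
  rewrite normrM gtr0_norm//; apply: (@le_trans _ _ (r i * `|d i|)).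
    by rewrite ler_wpM2r// bigmin_le.
  by rewrite /r mulrAC ler_pdivrMr// ler_wpM2l// lerDr.
case: (ltgtP (w i ord0) 0) (w0 i) => // wi _.
  rewrite ltr0_sg// (ltr0_norm wi) ler_norml => /andP[_ h].
  by rewrite ler0_norm ?mulrN1// -lerBrDl sub0r.
rewrite gtr0_sg// (gtr0_norm wi) ler_norml => /andP[h _].
by rewrite mulr1 ger0_norm// -lerBlDl sub0r.
Qed.

(** * The sign generator and measurability of the losses *)

Section game.
Context {R : realType} {n : nat} {dZ : measure_display}
  {Z : measurableType dZ}.
Variables (D : probability (vec R n * bool)%type R) (pz : probability Z R)
  (eps : R).
Hypothesis eps_ge0 : 0 <= eps.
Implicit Types (w : 'cV[R]_n) (g : generator R n Z).

Definition sign_generator w : generator R n Z :=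
  fun x y _ => sign_perturbation eps w x y.

Lemma sign_generator_admissible w : admissible eps (sign_generator w).
Proof.
split=> [|x y z]; last exact: sign_perturbation_ball.
(* For each of the two labels the generator is a translation. *)
rewrite (_ : (fun p => _) = (fun p : (vec R n * bool) * Z =>
    if p.1.2 then p.1.1 + - (eps *: vsign w) else p.1.1 + eps *: vsign w)).
  apply: measurable_fun_ifT.
  - exact: (measurableT_comp measurable_snd measurable_fst).
  - exact: (measurableT_comp (measurable_vec_translation (- (eps *: vsign w)))
      (measurableT_comp measurable_fst measurable_fst)).
  - exact: (measurableT_comp (measurable_vec_translation (eps *: vsign w))
      (measurableT_comp measurable_fst measurable_fst)).
apply/funext => -[[x y] z]/=; rewrite /sign_generator /sign_perturbation /label.
by case: y; rewrite ?mul1r// mulN1r scaleNr opprK.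
Qed.

Lemma measurable_label d (T : measurableType d) (f : T -> bool) :
  measurable_fun setT f -> measurable_fun setT (fun t => label (f t) : R).
Proof. by move=> mf; apply: measurable_fun_ifT. Qed.

Lemma measurable_loss w g : admissible eps g ->
  measurable_fun setT (fun p : (vec R n * bool) * Z =>
    logistic (- (label p.1.2 * linear_classifier w (g p.1.1 p.1.2 p.2)))).
Proof.
move=> [mg _]; apply: (measurableT_comp (measurable_logistic R)).
apply: measurable_funN; apply: measurable_funM.
  apply: measurable_label.
  exact: (measurableT_comp measurable_snd measurable_fst).
exact: (measurableT_comp (measurable_linear_classifier w) mg).
Qed.

Lemma measurable_shifted_loss w (c : R) :
  measurable_fun setT (fun p : vec R n * bool =>
    logistic (- (label p.2 * linear_classifier w p.1) + c)).
Proof.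
apply: (measurableT_comp (measurable_logistic R)); apply: measurable_funD => //.
apply: measurable_funN; apply: measurable_funM.
  by apply: measurable_label; exact: measurable_snd.
exact: (measurableT_comp (measurable_linear_classifier w) measurable_fst).
Qed.

(** By Tonelli, the inner integral over [Z] is that of a constant against a probability. *)
Lemma expectation_prod_fst (f : vec R n * bool -> R) :
  measurable_fun setT f -> (forall p, 0 <= f p) ->
  ('E_(D \x pz)[f \o fst] = 'E_D[f])%E.
Proof.
move=> mf f0; rewrite unlock fubini_tonelli1.
- apply: eq_integral => p _; rewrite /fubini_F/=.
  rewrite -[RHS]mule1 -(probability_setT pz).
  exact: (integral_cst pz measurableT (f p)%:E).
- apply/measurable_EFinP; exact: (measurableT_comp mf measurable_fst).
- by move=> p /=; rewrite lee_fin.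
Qed.

(** * Best responses and the regularized risk *)

Lemma payoff_sign_generator w w' :
  payoff D pz (linear_classifier w') (sign_generator w) =
  'E_D[fun p : vec R n * bool => logistic (- (label p.2 *
    linear_classifier w' p.1) + eps * linear_classifier w' (vsign w))]%E.
Proof.
rewrite -expectation_prod_fst; last 2 first.
- exact: measurable_shifted_loss.
- by move=> p; exact: logistic_ge0.
congr expectation; apply/funext => -[[x y] z]/=.
by rewrite -/(logistic _) /sign_generator margin_sign_perturbation opprB addrC.
Qed.

(** The hypothesis states that the signs of [w'] and [w] are compatible. It is used for [w' = w] and
    for a point of the segment leaving [w]. *)
Lemma payoff_sign_generator_l1 w w' :
  linear_classifier w' (vsign w) = l1norm w' ->
  payoff D pz (linear_classifier w') (sign_generator w) =
  regularized_risk D eps w'.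
Proof. by move=> ww'; rewrite payoff_sign_generator ww'. Qed.

Lemma loss_le w g (p : (vec R n * bool) * Z) : admissible eps g ->
  logistic (- (label p.1.2 * linear_classifier w (g p.1.1 p.1.2 p.2))) <=
  logistic (- (label p.1.2 *
    linear_classifier w (sign_generator w p.1.1 p.1.2 p.2))).
Proof.
move=> [_ ag]; rewrite ler_logistic lerN2 margin_sign_perturbation.
by rewrite linear_classifier_vsign margin_perturbation_ge.
Qed.

Lemma payoff_le_regularized_risk w g : admissible eps g ->
  (payoff D pz (linear_classifier w) g <= regularized_risk D eps w)%E.
Proof.
move=> ag; rewrite -(payoff_sign_generator_l1 _ _ (linear_classifier_vsign w)).
apply: expectation_le.
- exact: measurable_loss.
- apply: measurable_loss; exact: sign_generator_admissible.
- by move=> p; exact: logistic_ge0.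
- by move=> p; exact: logistic_ge0.
- by apply: aeW => p; exact: loss_le.
Qed.

Lemma worst_caseE w : worst_case D pz eps w = regularized_risk D eps w.
Proof.
apply/eqP; rewrite eq_le; apply/andP; split.
  by apply: ge_ereal_sup => _ [g ag <-]; exact: payoff_le_regularized_risk.
apply: ereal_sup_ubound; exists (sign_generator w).
  exact: sign_generator_admissible.
apply: payoff_sign_generator_l1; exact: linear_classifier_vsign.
Qed.

Lemma payoff_ge0 f g : (0 <= payoff D pz f g)%E.
Proof. by apply: expectation_ge0 => p; exact: logistic_ge0. Qed.

(** * Convexity of the payoff and the saddle inequality *)

(** Pointwise convexity of the loss is integrated; as the losses are nonnegative, linearity of the
    integral holds even for infinite payoffs. *)
Lemma payoff_convex g w w' (t : R) : admissible eps g -> 0 <= t <= 1 ->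
  (payoff D pz (linear_classifier ((1 - t) *: w + t *: w')) g <=
   (1 - t)%:E * payoff D pz (linear_classifier w) g +
   t%:E * payoff D pz (linear_classifier w') g)%E.
Proof.
move=> ag t01; have /andP[t0 t1] := t01.
have t1' : 0 <= 1 - t by rewrite subr_ge0.
have mw v := measurable_loss v g ag.
rewrite /payoff unlock -!ge0_integralZl_EFin//; last 4 first.
- by move=> p _; rewrite lee_fin; exact: logistic_ge0.
- apply/measurable_EFinP; exact: mw.
- by move=> p _; rewrite lee_fin; exact: logistic_ge0.
- apply/measurable_EFinP; exact: mw.
rewrite -ge0_integralD//; last 4 first.
- by move=> p _; rewrite -EFinM lee_fin mulr_ge0//; exact: logistic_ge0.
- by apply: measurable_funeM; apply/measurable_EFinP; exact: mw.
- by move=> p _; rewrite -EFinM lee_fin mulr_ge0//; exact: logistic_ge0.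
- by apply: measurable_funeM; apply/measurable_EFinP; exact: mw.
apply: ge0_le_integral => //.
- by move=> p _; rewrite lee_fin; exact: logistic_ge0.
- apply/measurable_EFinP; exact: mw.
- by apply: emeasurable_funD; apply: measurable_funeM;
    apply/measurable_EFinP; exact: mw.
move=> p _; rewrite -!EFinM -EFinD lee_fin linear_classifier_conv.
set a := linear_classifier w _; set b := linear_classifier w' _.
have -> : - (label p.1.2 * ((1 - t) * a + t * b)) =
    (1 - t) * - (label p.1.2 * a) + t * - (label p.1.2 * b) by ring.
exact: logistic_convex.
Qed.

Lemma regularized_risk_ge0 w : (0 <= regularized_risk D eps w)%E.
Proof. by apply: expectation_ge0 => p; exact: logistic_ge0. Qed.

Lemma argmin_regularized_risk_fin_num w :
  argmin (regularized_risk D eps) w -> regularized_risk D eps w \is a fin_num.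
Proof.
(* At the zero vector the loss is the constant [logistic 0], so the minimal risk is finite. *)
move=> /(_ 0) h; rewrite ge0_fin_numE ?regularized_risk_ge0//.
apply: le_lt_trans h _; rewrite /regularized_risk.
rewrite (_ : (fun p => _) = cst (logistic (0 : R))).
  by rewrite expectation_cst ltry.
apply/funext => p; rewrite linear_classifierE /l1norm !big1 ?mulr0 ?oppr0 ?addr0//.
  by move=> i _; rewrite mxE normr0.
by move=> i _; rewrite mxE mul0r.
Qed.

Lemma sign_generator_saddle w : argmin (regularized_risk D eps) w ->
  (forall i, w i ord0 != 0) -> forall w',
  (payoff D pz (linear_classifier w) (sign_generator w) <=
   payoff D pz (linear_classifier w') (sign_generator w))%E.
Proof.
move=> minw w0 w'.
have [t [t0 t1 wt]] := segment_same_signs _ _ w w' w0.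
have fin := argmin_regularized_risk_fin_num w minw.
have t01 : 0 <= t <= 1 by rewrite ltW.
have := payoff_convex _ w w' t (sign_generator_admissible w) t01.
rewrite (payoff_sign_generator_l1 _ _ wt).
rewrite (payoff_sign_generator_l1 _ _ (linear_classifier_vsign w)).
(* With [F] the payoff against the sign generator of [w], this gives
   [F w <= (1 - t) * F w + t * F w']. If [F w'] is finite, cancel the finite [F w] and divide by
   [t > 0]; otherwise the claim is trivial. *)
move=> /(le_trans (minw _)).
have := payoff_ge0 (linear_classifier w') (sign_generator w).
case: (payoff _ _ _ _) => [b| |] // _; last by rewrite leey.
rewrite -(fineK fin) -!EFinM -EFinD !lee_fin => h.
by rewrite -(ler_pM2l t0); lra.
Qed.

End game.

(** * From equal expectations to almost sure equality *)

(** The nonnegative function [Y - X] has integral zero; finiteness of the expectation of [X]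
    justifies the subtraction. *)
Lemma ae_eq_of_expectation_eq d (T : measurableType d) (R : realType)
    (P : probability T R) (X Y : T -> R) :
  measurable_fun setT X -> measurable_fun setT Y ->
  (forall x, 0 <= X x) -> (forall x, X x <= Y x) ->
  'E_P[X]%E \is a fin_num -> 'E_P[X]%E = 'E_P[Y]%E ->
  {ae P, forall x, X x = Y x}.
Proof.
move=> mX mY X0 XY finX EXY.
have YX0 x : 0 <= Y x - X x by rewrite subr_ge0.
have mYX : measurable_fun setT (fun x => (Y x - X x)%:E).
  by apply/measurable_EFinP; exact: measurable_funB.
have : (\int[P]_x `|(Y x - X x)%:E| = 0)%E.
  rewrite (eq_integral (fun x => (Y x - X x)%:E)); last first.
    by move=> x _; rewrite gee0_abs// lee_fin.
  move: EXY finX; rewrite unlock.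
  rewrite (eq_integral (fun x => ((X x)%:E + (Y x - X x)%:E)%E)
    (fun x => (Y x)%:E)); last first.
    by move=> x _; rewrite -EFinD subrKC.
  rewrite ge0_integralD//; last 3 first.
  - by move=> x _; rewrite lee_fin.
  - exact/measurable_EFinP.
  - by move=> x _; rewrite lee_fin.
  by move=> e fin; rewrite -[LHS](addeK _ fin) [X in (X - _)%E]addeC -e subee.
move/(ae_eq_integral_abs P measurableT mYX).
by apply: filterS => x /(_ I)[] /eqP; rewrite subr_eq0 => /eqP.
Qed.

(** * Optimal classifier, optimal generator and equilibrium *)

Theorem proposition2 (R : realType) (n : nat) (dZ : measure_display)
    (Z : measurableType dZ) (D : probability (vec R n * bool)%type R)
    (pz : probability Z R) (eps : R) (eps_ge0 : 0 <= eps) :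
  [/\ (* the inner maximum over generators is attained *)
      forall w : 'cV[R]_n, exists2 g : generator R n Z, admissible eps g &
        payoff D pz (linear_classifier w) g = worst_case D pz eps w,
      argmin (worst_case D pz eps) = argmin (regularized_risk D eps)
    & forall wstar : 'cV[R]_n, argmin (regularized_risk D eps) wstar ->
      (forall i : 'I_n, wstar i ord0 != 0) ->
      let gstar : generator R n Z :=
        fun x y _ => sign_perturbation eps wstar x y in
      [/\ optimal_generator D pz eps gstar,
          (* any optimal generator is gstar, up to a null set *)
          forall g : generator R n Z, optimal_generator D pz eps g ->
            {ae (D \x pz)%E, forall p : (vec R n * bool) * Z,
              g p.1.1 p.1.2 p.2 = gstar p.1.1 p.1.2 p.2}
        & nash_equilibrium D pz eps wstar gstar]].
Proof.
split.
- move=> w; exists (sign_generator eps w); first exact: sign_generator_admissible.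
  by rewrite worst_caseE// payoff_sign_generator_l1// linear_classifier_vsign.
- by congr argmin; apply/funext => w; exact: worst_caseE.
move=> w minw w0 gstar; rewrite -[gstar]/(sign_generator eps w).
have astar : admissible eps (sign_generator (Z := Z) eps w).
  exact: sign_generator_admissible.
have starE : payoff D pz (linear_classifier w) (sign_generator eps w) =
    regularized_risk D eps w.
  apply: payoff_sign_generator_l1; exact: linear_classifier_vsign.
have saddle := sign_generator_saddle D pz eps eps_ge0 w minw w0.
have value_le g : admissible eps g ->
    (generator_value D pz g <= payoff D pz (linear_classifier w) g)%E.
  by move=> ag; apply: ereal_inf_lbound; exists w.
(* By the saddle inequality, the infimum defining this value is attained at [w]. *)
have valueE : generator_value D pz (sign_generator eps w) =
    regularized_risk D eps w.
  apply/eqP; rewrite eq_le -{1}starE value_le//= -starE.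
  by apply: le_ereal_inf_tmp => _ [w' _ <-].
split.
- split=> // g ag; rewrite valueE (le_trans (value_le g ag))//.
  exact: payoff_le_regularized_risk.
- move=> g [ag optg].
  (* The payoff of [g] against [w] is squeezed: it is at most the risk of [w], which is the value of
     the sign generator, hence at most the value of the optimal [g], and this is at most the
     payoff. *)
  have Eg : payoff D pz (linear_classifier w) g =
      payoff D pz (linear_classifier w) (sign_generator eps w).
    apply/eqP; rewrite eq_le starE payoff_le_regularized_risk//=.
    by rewrite -valueE (le_trans (optg _ astar))// value_le.
  have fing : payoff D pz (linear_classifier w) g \is a fin_num.
    by rewrite Eg starE argmin_regularized_risk_fin_num.
  have := ae_eq_of_expectation_eq _ _ _ _ _ _ (measurable_loss _ w g ag)
    (measurable_loss _ w _ astar) (fun p => logistic_ge0 _ _)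
    (fun p => loss_le _ w g p ag) fing Eg.
  (* Injectivity of the loss turns equal losses into equal margins, the equality case of Hoelder's
     inequality. *)
  apply: filterS => p /logistic_inj/oppr_inj.
  rewrite margin_sign_perturbation linear_classifier_vsign.
  by apply: margin_perturbation_eq => //; exact: ag.2.
- split=> // g ag; rewrite starE; exact: payoff_le_regularized_risk.
Qed.
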